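(* Let $0<p<1$ and let $w:\mathbb{R}\to\mathbb{R}$ be a solution to (S) with zero-value $(\alpha,\beta)\in\bar D_{c^*(p)}'$. Then for any $\epsilon>0$ there exist $c_{1\epsilon},c_{2\epsilon}>0$ (dependent generally on $\alpha,\beta,p$ and $\epsilon$) such that $$|w(\eta)|<\frac{c_{1\epsilon}}{(1+|\eta|)^{\frac{2}{1-p}-\epsilon}}\quad\text{and}\quad |w'(\eta)|<\frac{c_{2\epsilon}}{(1+|\eta|)^{\frac{1+p}{1-p}-\epsilon}}\qquad\text{for all }\eta\in\mathbb{R}.$$
   Context: Fix $0<p<1$; $w|w|^{p-1}$ is taken to be $0$ at $w=0$. A solution $w:\mathbb{R}\to\mathbb{R}$ to (S) with zero-value $(\alpha,\beta)\in\mathbb{R}^2$ is a function $w\in C^2(\mathbb{R})\cap L^\infty(\mathbb{R})$ with $w''+\frac12\eta w'+w|w|^{p-1}-\frac{1}{1-p}w=0$ for all $\eta\in\mathbb{R}$, $w(0)=\alpha$, $w'(0)=\beta$. Define $V(x,y)=\frac12y^2-\frac{1}{2(1-p)}x^2+\frac{1}{1+p}|x|^{1+p}$ on $\mathbb{R}^2$ and $c^*(p)=\frac{(1-p)^{2/(1-p)}}{2(1+p)}$. For $0\le c\le c^*(p)$, $D_c$ denotes the interior of the closed level curve $V=c$ surrounding the origin, i.e. $D_c=\{(x,y): |x|<(1-p)^{1/(1-p)},\ V(x,y)<c\}$; for $c=c^*(p)$ the closed curve is formed by the two level curves joining $(-(1-p)^{1/(1-p)},0)$ to $((1-p)^{1/(1-p)},0)$.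 Finally $\bar D_{c^*(p)}'=\bar D_{c^*(p)}\setminus\{(\pm(1-p)^{1/(1-p)},0),(0,0)\}$, where $\bar D_{c^*(p)}$ is the closure of $D_{c^*(p)}$. *)

(* Defs.v *)
From Stdlib Require Import Reals.
From Coquelicot Require Import Coquelicot.

Open Scope R_scope.

(* |x|^a.  The case x = 0 is separate because Stdlib's Rpower 0 a is 1; the
   value 0 is the power for a > 0, and for a = p - 1 < 0 it only occurs in the
   product w |w|^(p-1), taken to be 0 at w = 0. *)
Definition abspow (x a : R) : R :=
  if Req_EM_T x 0 then 0 else Rpower (Rabs x) a.

(* Derive is total, so differentiability of every order is required
   separately. *)
Definition class_C2 (w : R -> R) : Prop :=
  (forall eta, ex_derive w eta) /\
  (forall eta, ex_derive (Derive w) eta) /\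
  (forall eta, continuous (Derive_n w 2) eta).

Definition bounded_fun (w : R -> R) : Prop :=
  exists M : R, forall eta, Rabs (w eta) <= M.

(* The self-similar profile equation, with zero-value (w 0, w' 0) = ab. *)
Definition is_solution (p : R) (ab : R * R) (w : R -> R) : Prop :=
  class_C2 w /\
  bounded_fun w /\
  (forall eta,
      Derive_n w 2 eta + 1 / 2 * eta * Derive w eta
      + w eta * abspow (w eta) (p - 1) - 1 / (1 - p) * w eta = 0) /\
  w 0 = fst ab /\
  Derive w 0 = snd ab.

Definition V (p x y : R) : R :=
  1 / 2 * y ^ 2 - 1 / (2 * (1 - p)) * x ^ 2 + 1 / (1 + p) * abspow x (1 + p).

Definition cstar (p : R) : R := Rpower (1 - p) (2 / (1 - p)) / (2 * (1 + p)).

Definition xstar (p : R) : R := Rpower (1 - p) (1 / (1 - p)).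

Definition D (p c : R) (z : R * R) : Prop :=
  Rabs (fst z) < xstar p /\ V p (fst z) (snd z) < c.

Definition closure {T : UniformSpace} (A : T -> Prop) (z : T) : Prop :=
  forall eps : posreal, exists u : T, ball z eps u /\ A u.

Definition Dbar' (p : R) (z : R * R) : Prop :=
  closure (D p (cstar p)) z /\
  z <> (xstar p, 0) /\ z <> (- xstar p, 0) /\ z <> (0, 0).

(* Main.v *)
Require Import Defs.
From Stdlib Require Import Reals Lra.
From Coquelicot Require Import Coquelicot.

Open Scope R_scope.

(** The energy [E = V p w w'] satisfies [E' = - t w'^2 / 2].  Starting in the closed
    well minus its corners, [w] stays strictly inside [|w| < xstar], and by time 1
    the energy has dropped below [cstar] by an amount depending only on the initial
    data, so afterwards [k |w|^(1+p) <= w f(w)] for some [k > 0], where [f] is the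
    restoring force.  Along the flow, [t^a (E + m (w w' / t + w^2 / 4))] is
    eventually decreasing as soon as
    [a pot(w) + (m a / 4 + k) w^2 <= m w f(w)], which bounds [E t^a].  A small [a]
    is always possible, so [w] tends to 0; then [w^2] is negligible with respect to
    [|w|^(1+p)], and the same argument gives every [a].  The choice
    [a = 2 (1+p) / (1-p)] yields the theorem even without the loss [eps].  Negative
    times follow by the symmetry [t -> - t]. *)

(** * Monotonicity from the derivative, and the calculus of [|x|^a] *)

Lemma is_derive_nonpos_decr (f df : R -> R) (a b : R) :
  a <= b -> (forall x, a <= x <= b -> is_derive f x (df x)) ->
  (forall x, a <= x <= b -> df x <= 0) -> f b <= f a.
Proof.
intros Hab Hd Hneg.
destruct (MVT_gen f a b df) as [c [Hc Hfc]].
- intros x Hx. rewrite Rmin_left, Rmax_right in Hx by lra. apply Hd; lra.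
- intros x Hx. rewrite Rmin_left, Rmax_right in Hx by lra.
  apply derivable_continuous_pt. exists (df x). apply is_derive_Reals, Hd; lra.
- rewrite Rmin_left, Rmax_right in Hc by lra.
  specialize (Hneg c Hc). nra.
Qed.

Lemma abspow_neq0 (x a : R) : x <> 0 -> abspow x a = Rpower (Rabs x) a.
Proof. intros Hx; unfold abspow; destruct (Req_EM_T x 0); [easy | reflexivity]. Qed.

Lemma abspow_0 (a : R) : abspow 0 a = 0.
Proof. unfold abspow; destruct (Req_EM_T 0 0); [reflexivity | easy]. Qed.

Lemma abspow_ge0 (x a : R) : 0 <= abspow x a.
Proof.
unfold abspow; destruct (Req_EM_T x 0); [lra | left; apply exp_pos].
Qed.

Lemma abspow_pos (x a : R) : x <> 0 -> 0 < abspow x a.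
Proof. intros Hx; rewrite abspow_neq0 by easy; apply exp_pos. Qed.

Lemma abspow_Rabs (x a : R) : abspow (Rabs x) a = abspow x a.
Proof.
destruct (Req_dec x 0) as [-> | Hx]; [now rewrite Rabs_R0 |].
rewrite !abspow_neq0; [now rewrite Rabs_Rabsolu | easy | now apply Rabs_no_R0].
Qed.

Lemma abspow_le (x y a : R) : 0 < a -> Rabs x <= Rabs y -> abspow x a <= abspow y a.
Proof.
intros Ha Hxy.
destruct (Req_dec x 0) as [-> | Hx]; [rewrite abspow_0; apply abspow_ge0 |].
pose proof (Rabs_pos_lt x Hx).
assert (Hy : y <> 0) by (intros ->; rewrite Rabs_R0 in Hxy; lra).
rewrite !abspow_neq0 by easy. apply Rle_Rpower_l; lra.
Qed.

Lemma abspow_lt (x y a : R) : 0 < a -> Rabs x < Rabs y -> abspow x a < abspow y a.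
Proof.
intros Ha Hxy.
assert (Hy : y <> 0) by (intros ->; rewrite Rabs_R0 in Hxy; pose proof (Rabs_pos x); lra).
destruct (Req_dec x 0) as [-> | Hx]; [rewrite abspow_0; now apply abspow_pos |].
pose proof (Rabs_pos_lt x Hx).
rewrite !abspow_neq0 by easy. apply exp_increasing, Rmult_lt_compat_l; [easy |].
apply ln_increasing; lra.
Qed.

Lemma abspow_mult (x a b : R) : abspow x a * abspow x b = abspow x (a + b).
Proof.
destruct (Req_dec x 0) as [-> | Hx]; [rewrite !abspow_0; ring |].
rewrite !abspow_neq0 by easy. now rewrite Rpower_plus.
Qed.

Lemma abspow_mult_distr (x y a : R) : abspow (x * y) a = abspow x a * abspow y a.
Proof.
destruct (Req_dec x 0) as [-> | Hx]; [rewrite Rmult_0_l, !abspow_0; ring |].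
destruct (Req_dec y 0) as [-> | Hy]; [rewrite Rmult_0_r, !abspow_0; ring |].
rewrite !abspow_neq0 by (try easy; now apply Rmult_integral_contrapositive).
rewrite Rabs_mult, Rpower_mult_distr by now apply Rabs_pos_lt. reflexivity.
Qed.

Lemma abspow_1 (x : R) : abspow x 1 = Rabs x.
Proof.
destruct (Req_dec x 0) as [-> | Hx]; [now rewrite abspow_0, Rabs_R0 |].
rewrite abspow_neq0 by easy. apply Rpower_1. now apply Rabs_pos_lt.
Qed.

Lemma abspow_2 (x : R) : abspow x 2 = x ^ 2.
Proof.
replace 2 with (1 + 1) at 1 by ring. rewrite <- abspow_mult, abspow_1.
rewrite <- Rabs_mult, Rabs_pos_eq; [ring | nra].
Qed.

Lemma sqr_abspow (x a b : R) : a + b = 2 -> x ^ 2 = abspow x a * abspow x b.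
Proof. intros H; now rewrite abspow_mult, H, abspow_2. Qed.

Lemma continuous_abspow_0 (a : R) : 0 < a ->
  forall e, 0 < e -> exists d, 0 < d /\ forall h, Rabs h < d -> abspow h a < e.
Proof.
intros Ha e He. exists (Rpower e (/ a)). split; [apply exp_pos |].
intros h Hh.
destruct (Req_dec h 0) as [-> | Hh0]; [now rewrite abspow_0 |].
rewrite abspow_neq0 by easy. rewrite <- (Rpower_1 e) by easy.
replace 1 with (/ a * a) by (field; lra). rewrite <- Rpower_mult.
pose proof (Rabs_pos_lt h Hh0).
apply exp_increasing, Rmult_lt_compat_l; [easy |]. now apply ln_increasing.
Qed.

Lemma Rpower_sub_2 (p y : R) : 0 < y -> Rpower y (p - 1) = Rpower y (1 + p) / y ^ 2.
Proof.
intros Hy. replace (1 + p) with ((p - 1) + (1 + 1)) by ring.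
rewrite (Rpower_plus (p - 1)), (Rpower_plus 1 1), Rpower_1 by easy. field. lra.
Qed.

(** Away from 0 the power is locally an exponential of a logarithm. At 0 the difference quotient has
    absolute value [|h|^p], which tends to 0 because [p > 0]; this agrees with the convention that
    makes [x * abspow x (p - 1)] vanish there. *)
Lemma is_derive_abspow (p x : R) : 0 < p ->
  is_derive (fun t => abspow t (1 + p)) x ((1 + p) * (x * abspow x (p - 1))).
Proof.
intros Hp.
destruct (Rtotal_order x 0) as [Hx | [-> | Hx]].
- apply (is_derive_ext_loc (fun t => exp ((1 + p) * ln (- t)))).
  + exists (mkposreal (- x) ltac:(lra)). intros t Ht.
    apply Rabs_lt_between' in Ht; simpl in Ht.
    rewrite abspow_neq0, Rabs_left by lra. reflexivity.
  + auto_derive; [lra |]. rewrite abspow_neq0, Rabs_left by lra.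
    rewrite Rpower_sub_2 by lra. unfold Rpower. field. lra.
- rewrite Rmult_0_l, Rmult_0_r. apply is_derive_Reals.
  intros e He. destruct (continuous_abspow_0 p Hp e He) as [d [Hd Hb]].
  exists (mkposreal d Hd). intros h Hh Hhd. simpl in Hhd.
  rewrite abspow_0, Rplus_0_l, !Rminus_0_r, <- abspow_mult, abspow_1.
  unfold Rdiv. rewrite !Rabs_mult, Rabs_inv, Rabs_Rabsolu.
  rewrite (Rabs_pos_eq (abspow h p)) by apply abspow_ge0.
  replace (Rabs h * abspow h p * / Rabs h) with (abspow h p)
    by (field; now apply Rabs_no_R0).
  now apply Hb.
- apply (is_derive_ext_loc (fun t => exp ((1 + p) * ln t))).
  + exists (mkposreal x Hx). intros t Ht.
    apply Rabs_lt_between' in Ht; simpl in Ht.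
    rewrite abspow_neq0, Rabs_pos_eq by lra. reflexivity.
  + auto_derive; [lra |]. rewrite abspow_neq0, Rabs_pos_eq by lra.
    rewrite Rpower_sub_2 by lra. unfold Rpower. field. lra.
Qed.

(** * The potential well and the restoring force *)

Definition pot (p x : R) : R :=
  1 / (1 + p) * abspow x (1 + p) - 1 / (2 * (1 - p)) * x ^ 2.

Definition force (p x : R) : R := x * abspow x (p - 1) - 1 / (1 - p) * x.

Lemma V_pot (p x y : R) : V p x y = 1 / 2 * y ^ 2 + pot p x.
Proof. unfold V, pot; ring. Qed.

Lemma is_derive_pot (p x : R) : 0 < p < 1 -> is_derive (pot p) x (force p x).
Proof.
intros Hp. pose proof (is_derive_abspow p x ltac:(lra)) as Hd.
set (g := fun t => abspow t (1 + p)).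
change (is_derive g x ((1 + p) * (x * abspow x (p - 1)))) in Hd.
apply (is_derive_ext (fun t => 1 / (1 + p) * g t - 1 / (2 * (1 - p)) * t ^ 2));
  [reflexivity |].
clearbody g. auto_derive; [repeat split; eexists; exact Hd |].
replace (Derive (fun t : R => g t) x) with ((1 + p) * (x * abspow x (p - 1)))
  by (symmetry; exact (is_derive_unique _ _ _ Hd)).
unfold force. field. lra.
Qed.

(** Removes the singular power [p - 1]: every later estimate on the force becomes a comparison of
    [x^2] with [|x|^(1+p)]. *)
Lemma force_mul (p x : R) : x * force p x = abspow x (1 + p) - 1 / (1 - p) * x ^ 2.
Proof.
unfold force. replace (1 + p) with (2 + (p - 1)) by ring.
rewrite <- abspow_mult, abspow_2. ring.
Qed.

Lemma xstar_gt0 (p : R) : 0 < xstar p.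
Proof. apply exp_pos. Qed.

(** This identifies [xstar] as the positive zero of the force, where [|x|^(p-1) = 1/(1-p)]. *)
Lemma xstar_pow (p : R) : p < 1 -> abspow (xstar p) (1 - p) = 1 - p.
Proof.
intros Hp. pose proof (xstar_gt0 p).
rewrite abspow_neq0, Rabs_pos_eq by lra. unfold xstar. rewrite Rpower_mult.
replace (1 / (1 - p) * (1 - p)) with 1 by (field; lra). apply Rpower_1; lra.
Qed.

Lemma cstar_xstar (p : R) : p < 1 -> cstar p = xstar p ^ 2 / (2 * (1 + p)).
Proof.
intros Hp. unfold cstar, xstar. f_equal.
simpl. rewrite Rmult_1_r, <- Rpower_plus. f_equal. field. lra.
Qed.

Lemma pot_xstar (p x : R) : 0 < p < 1 -> Rabs x = xstar p -> pot p x = cstar p.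
Proof.
intros Hp Hx.
assert (H : x ^ 2 = (1 - p) * abspow x (1 + p)).
{ rewrite (sqr_abspow x (1 - p) (1 + p)) by ring.
  rewrite <- (abspow_Rabs x (1 - p)), Hx, xstar_pow by lra. ring. }
rewrite cstar_xstar, <- Hx, pow2_abs, H by lra. unfold pot. rewrite H. field. lra.
Qed.

Lemma xstar_lt1 (p : R) : 0 < p < 1 -> xstar p < 1.
Proof.
intros Hp.
assert (Hl : ln (1 - p) < 0) by (rewrite <- ln_1; apply ln_increasing; lra).
assert (Hq : 0 < 1 / (1 - p)) by (apply Rdiv_lt_0_compat; lra).
rewrite <- exp_0. unfold xstar, Rpower. apply exp_increasing. nra.
Qed.

(** Split [x^2 = |x|^(1-p) |x|^(1+p)] and bound the first factor. Small [r] makes [x^2] negligible;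
    [r = xstar] gives the sharp constant [1 - p] of the well. *)
Lemma sqr_le_abspow (p r x : R) : 0 < p < 1 -> Rabs x <= Rabs r ->
  x ^ 2 <= abspow r (1 - p) * abspow x (1 + p).
Proof.
intros Hp Hx. rewrite (sqr_abspow x (1 - p) (1 + p)) by ring.
apply Rmult_le_compat_r; [apply abspow_ge0 |]. apply abspow_le; lra.
Qed.

Lemma sqr_le_xstar (p x : R) : 0 < p < 1 -> Rabs x <= xstar p ->
  x ^ 2 <= (1 - p) * abspow x (1 + p).
Proof.
intros Hp Hx. pose proof (xstar_gt0 p). rewrite <- (xstar_pow p) by lra.
apply sqr_le_abspow; [easy |]. now rewrite (Rabs_pos_eq (xstar p)) by lra.
Qed.

Lemma pot_lower (p x : R) : 0 < p < 1 -> Rabs x <= xstar p ->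
  (1 - p) / (2 * (1 + p)) * abspow x (1 + p) <= pot p x.
Proof.
intros Hp Hx. pose proof (sqr_le_xstar p x Hp Hx) as H. unfold pot.
assert (1 / (2 * (1 - p)) * x ^ 2 <= 1 / 2 * abspow x (1 + p)).
{ replace (1 / 2 * abspow x (1 + p))
    with (1 / (2 * (1 - p)) * ((1 - p) * abspow x (1 + p))) by (field; lra).
  apply Rmult_le_compat_l; [| easy]. left; apply Rdiv_lt_0_compat; lra. }
replace ((1 - p) / (2 * (1 + p))) with (1 / (1 + p) - 1 / 2) by (field; lra).
lra.
Qed.

Lemma pot_upper (p x : R) : 0 < p < 1 -> pot p x <= abspow x (1 + p).
Proof.
intros Hp. unfold pot. pose proof (abspow_ge0 x (1 + p)).
assert (0 < 1 / (2 * (1 - p))) by (apply Rdiv_lt_0_compat; lra).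
assert (1 / (1 + p) <= 1) by (apply Rle_div_l; lra).
pose proof (pow2_ge_0 x). nra.
Qed.

Lemma pot_ge0 (p x : R) : 0 < p < 1 -> Rabs x <= xstar p -> 0 <= pot p x.
Proof.
intros Hp Hx. eapply Rle_trans; [| now apply pot_lower].
apply Rmult_le_pos; [left; apply Rdiv_lt_0_compat; lra | apply abspow_ge0].
Qed.

Lemma pot_Rabs (p x : R) : pot p (Rabs x) = pot p x.
Proof. unfold pot. now rewrite abspow_Rabs, pow2_abs. Qed.

(** On the well [x * force p x >= 0], by [force_mul] and [sqr_le_xstar], so the force is nonnegative
    for [x >= 0]. *)
Lemma pot_incr (p x y : R) : 0 < p < 1 -> 0 <= x <= y -> y <= xstar p ->
  pot p x <= pot p y.
Proof.
intros Hp Hxy Hy.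
enough (- pot p y <= - pot p x) by lra.
apply (is_derive_nonpos_decr (fun t => - pot p t) (fun t => - force p t)); [lra | |].
- intros t _. apply @is_derive_opp. now apply is_derive_pot.
- intros t Ht.
  destruct (Req_dec t 0) as [-> | Ht0]; [unfold force; lra |].
  assert (H : 0 <= t * force p t).
  { rewrite force_mul. assert (H := sqr_le_xstar p t Hp).
    rewrite Rabs_pos_eq in H by lra. specialize (H ltac:(lra)).
    apply Rmult_le_compat_l with (r := 1 / (1 - p)) in H;
      [| left; apply Rdiv_lt_0_compat; lra].
    replace (1 / (1 - p) * ((1 - p) * abspow t (1 + p)))
      with (abspow t (1 + p)) in H by (field; lra). lra. }
  nra.
Qed.

(** By continuity at the corner some [r < xstar] has potential above [cstar - d], so monotonicity
    confines [x] to [|x| <= r]. There [x^2 <= r^(1-p) |x|^(1+p)] with [r^(1-p) < 1 - p], and the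
    ratio of these two numbers gives [k]. *)
Lemma pot_gap (p d : R) : 0 < p < 1 -> 0 < d ->
  exists k, 0 < k < 1 /\ forall x, Rabs x < xstar p -> pot p x <= cstar p - d ->
    k * abspow x (1 + p) <= x * force p x.
Proof.
intros Hp Hd. pose proof (xstar_gt0 p) as Hs.
assert (Hc : continuity_pt (pot p) (xstar p)).
{ apply derivable_continuous_pt. exists (force p (xstar p)).
  now apply is_derive_Reals, is_derive_pot. }
destruct (Hc d Hd) as [e [He Hlim]]. simpl in Hlim. unfold R_dist in Hlim.
(* The first entry keeps [r] positive, the second keeps it within [e] of the corner. *)
set (r := Rmax (xstar p / 2) (xstar p - e / 2)).
assert (Hr : 0 < r < xstar p /\ xstar p - r < e).
{ unfold r. pose proof (Rmax_l (xstar p / 2) (xstar p - e / 2)).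
  pose proof (Rmax_r (xstar p / 2) (xstar p - e / 2)).
  repeat split; try lra. apply Rmax_lub_lt; lra. }
assert (Hpr : cstar p - d < pot p r).
{ assert (H : Rabs (pot p r - pot p (xstar p)) < d).
  { apply Hlim. split; [split; [exact I | lra] |].
    rewrite Rabs_left; lra. }
  rewrite (pot_xstar p (xstar p)) in H by (try easy; apply Rabs_pos_eq; lra).
  apply Rabs_lt_between in H. lra. }
assert (Hq : abspow r (1 - p) < 1 - p).
{ rewrite <- (xstar_pow p) at 2 by lra. apply abspow_lt; [lra |].
  rewrite !Rabs_pos_eq; lra. }
assert (Hq0 : 0 < abspow r (1 - p)) by (apply abspow_pos; lra).
exists (1 - abspow r (1 - p) / (1 - p)). split.
{ assert (abspow r (1 - p) / (1 - p) < 1) by (apply Rlt_div_l; lra).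
  assert (0 < abspow r (1 - p) / (1 - p)) by (apply Rdiv_lt_0_compat; lra). lra. }
intros x Hx Hpx.
assert (Hxr : Rabs x <= r).
{ destruct (Rle_or_lt (Rabs x) r) as [| Hlt]; [easy |].
  rewrite <- pot_Rabs in Hpx. assert (pot p r <= pot p (Rabs x)); [| lra].
  apply pot_incr; lra. }
rewrite force_mul.
assert (H : x ^ 2 <= abspow r (1 - p) * abspow x (1 + p)).
{ apply sqr_le_abspow; [easy |]. now rewrite (Rabs_pos_eq r) by lra. }
apply Rmult_le_compat_l with (r := 1 / (1 - p)) in H;
  [| left; apply Rdiv_lt_0_compat; lra].
replace ((1 - abspow r (1 - p) / (1 - p)) * abspow x (1 + p))
  with (abspow x (1 + p) - 1 / (1 - p) * (abspow r (1 - p) * abspow x (1 + p)))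
  by (field; lra).
lra.
Qed.

(** [pot_incr] is only a weak inequality. Strictness comes from the mean value theorem on an
    interval [[a, b]] with [|x| < a] and [b < xstar], so that the force is positive even at its
    endpoints. *)
Lemma pot_lt_cstar (p x : R) : 0 < p < 1 -> Rabs x < xstar p -> pot p x < cstar p.
Proof.
intros Hp Hx. pose proof (Rabs_pos x). rewrite <- pot_Rabs.
set (a := (Rabs x + xstar p) / 2). set (b := (a + xstar p) / 2).
assert (Hab : Rabs x < a /\ a < b /\ b < xstar p) by (unfold b, a; lra).
destruct (MVT_gen (pot p) a b (force p)) as [c [Hc Hfc]].
- intros t _. now apply is_derive_pot.
- intros t _. apply derivable_continuous_pt. exists (force p t).
  now apply is_derive_Reals, is_derive_pot.
- rewrite Rmin_left, Rmax_right in Hc by lra.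
  assert (Hq : 0 < c * force p c).
  { rewrite force_mul, (sqr_abspow c (1 - p) (1 + p)) by ring.
    assert (abspow c (1 - p) < 1 - p).
    { rewrite <- (xstar_pow p) at 2 by lra. apply abspow_lt; [lra |].
      rewrite !Rabs_pos_eq; lra. }
    assert (0 < abspow c (1 + p)) by (apply abspow_pos; lra).
    replace (abspow c (1 + p) - 1 / (1 - p) * (abspow c (1 - p) * abspow c (1 + p)))
      with (abspow c (1 + p) * ((1 - p) - abspow c (1 - p)) / (1 - p)) by (field; lra).
    apply Rdiv_lt_0_compat; [apply Rmult_lt_0_compat |]; lra. }
  assert (0 < force p c) by nra.
  assert (pot p (Rabs x) <= pot p a) by (apply pot_incr; lra).
  assert (pot p b <= cstar p).
  { rewrite <- (pot_xstar p (xstar p)) by (try easy; apply Rabs_pos_eq; lra).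
    apply pot_incr; lra. }
  assert (0 < force p c * (b - a)) by (apply Rmult_lt_0_compat; lra).
  lra.
Qed.

Lemma cstar_le_half (p : R) : 0 < p < 1 -> cstar p <= 1 / 2.
Proof.
intros Hp. rewrite cstar_xstar by lra.
pose proof (xstar_lt1 p Hp). pose proof (xstar_gt0 p).
apply Rle_div_l; [lra | nra].
Qed.

(** * The profile equation as a first-order system, and its energy *)

Definition profile (p : R) (w dw : R -> R) : Prop :=
  forall t, is_derive w t (dw t) /\
            is_derive dw t (- (1 / 2 * t * dw t + force p (w t))).

Lemma is_derive_comp_R (f g : R -> R) (x df dg : R) :
  is_derive f (g x) df -> is_derive g x dg ->
  is_derive (fun t => f (g t)) x (df * dg).
Proof.
intros Hf Hg. rewrite Rmult_comm. exact (is_derive_comp f g x df dg Hf Hg).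
Qed.

Lemma is_derive_energy (p : R) (w dw : R -> R) (t : R) :
  0 < p < 1 -> profile p w dw ->
  is_derive (fun s => V p (w s) (dw s)) t (- (1 / 2) * t * dw t ^ 2).
Proof.
intros Hp Hw. destruct (Hw t) as [H1 H2].
pose proof (is_derive_comp_R _ _ _ _ _ (is_derive_pot p (w t) Hp) H1) as H3.
set (g := fun s => pot p (w s)).
change (is_derive g t (force p (w t) * dw t)) in H3.
apply (is_derive_ext (fun s => 1 / 2 * dw s ^ 2 + g s)).
{ intros s. now rewrite V_pot. }
clearbody g. auto_derive; [repeat split; eexists; eassumption |].
replace (Derive (fun t : R => g t) t) with (force p (w t) * dw t)
  by (symmetry; exact (is_derive_unique _ _ _ H3)).
replace (Derive (fun t : R => dw t) t) with (- (1 / 2 * t * dw t + force p (w t)))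
  by (symmetry; exact (is_derive_unique _ _ _ H2)).
field.
Qed.

Lemma energy_decr (p : R) (w dw : R -> R) (s t : R) :
  0 < p < 1 -> profile p w dw -> 0 <= s <= t ->
  V p (w t) (dw t) <= V p (w s) (dw s).
Proof.
intros Hp Hw Hst.
apply (is_derive_nonpos_decr (fun r => V p (w r) (dw r))
         (fun r => - (1 / 2) * r * dw r ^ 2)); [lra | |].
- intros r _. now apply is_derive_energy.
- intros r Hr. pose proof (pow2_ge_0 (dw r)). nra.
Qed.

(* Reaching |w| = xstar needs the whole energy cstar, so the energy would have
   been constant, hence w' = 0, up to that time. *)
Lemma trapped (p : R) (w dw : R -> R) :
  0 < p < 1 -> profile p w dw ->
  Rabs (w 0) < xstar p -> V p (w 0) (dw 0) <= cstar p ->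
  forall t, 0 <= t -> Rabs (w t) < xstar p.
Proof.
intros Hp Hw Hw0 HV t Ht.
destruct (Rlt_or_le (Rabs (w t)) (xstar p)) as [| Hge]; [easy | exfalso].
assert (Hcw : forall s, continuous w s).
{ intros s. apply (ex_derive_continuous w). exists (dw s). apply Hw. }
destruct (IVT_gen (fun s => Rabs (w s)) 0 t (xstar p)) as [r [Hr Hwr]].
{ intros s. apply continuity_pt_filterlim.
  apply (continuous_comp w Rabs); [apply Hcw | apply continuous_Rabs]. }
{ split; [apply Rle_trans with (Rabs (w 0)); [apply Rmin_l | lra]
         | apply Rle_trans with (Rabs (w t)); [lra | apply Rmax_r]]. }
rewrite Rmin_left, Rmax_right in Hr by lra.
assert (HVr : cstar p <= V p (w r) (dw r)).
{ rewrite V_pot, (pot_xstar p (w r)) by easy. pose proof (pow2_ge_0 (dw r)). lra. }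
assert (Hconst : forall s, 0 < s < r -> dw s = 0).
{ intros s Hs.
  assert (H0 : - (1 / 2) * s * dw s ^ 2 = 0).
  { rewrite <- (is_derive_unique _ _ _ (is_derive_energy p w dw s Hp Hw)).
    apply is_derive_unique, (is_derive_ext_loc (fun _ => cstar p));
      [| apply @is_derive_const].
    apply (locally_interval _ s 0 r); simpl; try lra.
    intros y Hy0 Hyr. symmetry. apply Rle_antisym.
    - apply Rle_trans with (V p (w 0) (dw 0)); [apply energy_decr |]; try easy; lra.
    - apply Rle_trans with (V p (w r) (dw r)); [| apply energy_decr]; try easy; lra. }
  assert (dw s ^ 2 = 0) by nra. nra. }
destruct (MVT_gen w 0 r (fun _ => 0)) as [c [_ Hc]].
- intros s Hs. rewrite Rmin_left, Rmax_right in Hs by lra.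
  rewrite <- (Hconst s Hs). apply Hw.
- intros s _. apply continuity_pt_filterlim, Hcw.
- replace (w r) with (w 0) in Hwr by lra. lra.
Qed.

(** * Bounds inside the well and the energy lost by time 1 *)

(** The form in which the closed well enters the estimates: strictness of the first bound rules out
    the corners. *)
Definition admissible (p a b : R) : Prop :=
  Rabs a < xstar p /\ V p a b <= cstar p.

(** Since [xstar < 1] and [cstar <= 1/2], the numerical bounds are the same for all admissible data,
    so later constants can be fixed before the solution is given. *)
Lemma profile_bounds (p : R) (w dw : R -> R) :
  0 < p < 1 -> profile p w dw -> admissible p (w 0) (dw 0) ->
  forall t, 0 <= t ->
  Rabs (w t) < xstar p /\ Rabs (w t) <= 1 /\ V p (w t) (dw t) <= 1 / 2 /\
  0 <= pot p (w t) /\ dw t ^ 2 <= 2 * V p (w t) (dw t) /\ Rabs (dw t) <= 1.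
Proof.
intros Hp Hw [H0 H1] t Ht.
pose proof (trapped p w dw Hp Hw H0 H1 t Ht) as Hx.
pose proof (xstar_lt1 p Hp). pose proof (cstar_le_half p Hp).
pose proof (energy_decr p w dw 0 t Hp Hw ltac:(lra)).
pose proof (pot_ge0 p (w t) Hp ltac:(lra)).
assert (dw t ^ 2 <= 2 * V p (w t) (dw t)) by (rewrite V_pot; lra).
repeat split; try lra.
apply Rabs_le. split; nra.
Qed.

Lemma force_bound (p x : R) : 0 < p < 1 -> Rabs x <= 1 ->
  Rabs (force p x) <= 1 + 1 / (1 - p).
Proof.
intros Hp Hx. assert (0 < 1 / (1 - p)) by (apply Rdiv_lt_0_compat; lra).
unfold force. eapply Rle_trans; [apply Rabs_triang |].
rewrite Rabs_Ropp, !Rabs_mult, (Rabs_pos_eq (abspow _ _)) by apply abspow_ge0.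
rewrite (Rabs_pos_eq (1 / (1 - p))) by lra.
rewrite <- (abspow_1 x) at 1. rewrite abspow_mult.
replace (1 + (p - 1)) with p by ring.
assert (abspow x p <= 1).
{ replace 1 with (abspow 1 p).
  - apply abspow_le; [lra |]. now rewrite Rabs_R1.
  - rewrite abspow_neq0, Rabs_R1 by lra. unfold Rpower.
    now rewrite ln_1, Rmult_0_r, exp_0. }
nra.
Qed.

(** If [b = 0], the initial point already lies strictly below [cstar]. Otherwise the acceleration is
    bounded, so [|w'|] stays above [|b|/2] for a short time and the damping consumes a definite
    amount of energy. *)
Lemma energy_gap (p a b : R) : 0 < p < 1 -> admissible p a b ->
  exists d, 0 < d /\ forall w dw, profile p w dw -> w 0 = a -> dw 0 = b ->
    forall t, 1 <= t -> V p (w t) (dw t) <= cstar p - d.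
Proof.
intros Hp Hab.
assert (Hip : 0 < 1 / (1 - p)) by (apply Rdiv_lt_0_compat; lra).
(* [K] bounds [|w''|] on [[0, 1]]: the damping contributes at most [1/2], the force at most
   [1 + 1/(1-p)]. *)
set (K := 2 + 1 / (1 - p)).
assert (HK : 2 < K) by (unfold K; lra).
pose proof (Rabs_pos b) as Hb.
(* Chosen so that [w'] changes by at most [K h <= |b|/2] on [[0, h]]. *)
set (h := Rmin 1 (Rabs b / (2 * K))).
assert (Hh : 0 <= h <= 1 /\ 2 * K * h <= Rabs b).
{ pose proof (Rmin_l 1 (Rabs b / (2 * K))) as H1.
  pose proof (Rmin_r 1 (Rabs b / (2 * K))) as H. fold h in H, H1. repeat split; [| lra |].
  - apply Rmin_glb; [lra |]. apply Rdiv_le_0_compat; lra.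
  - apply Rle_div_r in H; [| lra]. lra. }
(* The last term is the integral over [[0, h]] of [(s/2) (b/2)^2], a lower bound for the dissipated
   energy. *)
exists (cstar p - V p a b + h ^ 2 * b ^ 2 / 16). split.
{ destruct Hab as [Ha HV]. destruct (Req_dec b 0) as [-> | Hb0].
  - assert (V p a 0 < cstar p); [| nra].
    rewrite V_pot. pose proof (pot_lt_cstar p a Hp Ha). lra.
  - apply Rabs_pos_lt in Hb0.
    assert (0 < h) by (apply Rmin_glb_lt; [| apply Rdiv_lt_0_compat]; lra).
    assert (0 < b ^ 2) by (rewrite <- pow2_abs; nra).
    assert (0 < h ^ 2) by nra.
    assert (0 < h ^ 2 * b ^ 2) by now apply Rmult_lt_0_compat. lra. }
intros w dw Hw Hw0 Hdw0 t Ht. subst a b.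
pose proof (profile_bounds p w dw Hp Hw Hab) as HB.
assert (Hacc : forall s, 0 <= s <= 1 ->
  Rabs (- (1 / 2 * s * dw s + force p (w s))) <= K).
{ intros s Hs. destruct (HB s ltac:(lra)) as (_ & H1 & _ & _ & _ & H2).
  pose proof (force_bound p (w s) Hp H1).
  rewrite Rabs_Ropp. eapply Rle_trans; [apply Rabs_triang |].
  rewrite !Rabs_mult, (Rabs_pos_eq (1 / 2)), (Rabs_pos_eq s) by lra.
  unfold K. pose proof (Rabs_pos (dw s)). nra. }
assert (Hdw : forall s, 0 <= s <= 1 -> Rabs (dw s - dw 0) <= K * s).
{ intros s Hs.
  destruct (MVT_gen dw 0 s (fun s => - (1 / 2 * s * dw s + force p (w s)))) as [c [Hc Hd]].
  - intros r _. apply Hw.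
  - intros r _. apply continuity_pt_filterlim, (ex_derive_continuous dw).
    eexists. apply Hw.
  - rewrite Rmin_left, Rmax_right in Hc by lra.
    rewrite Hd, Rabs_mult, Rminus_0_r, (Rabs_pos_eq s) by lra.
    apply Rmult_le_compat_r; [lra |]. apply Hacc; lra. }
apply Rle_trans with (V p (w h) (dw h)); [apply energy_decr; try easy; lra |].
enough (H : V p (w h) (dw h) + h ^ 2 * dw 0 ^ 2 / 16
         <= V p (w 0) (dw 0) + 0 ^ 2 * dw 0 ^ 2 / 16) by lra.
apply (is_derive_nonpos_decr (fun s => V p (w s) (dw s) + s ^ 2 * dw 0 ^ 2 / 16)
  (fun s => - (1 / 2) * s * dw s ^ 2 + s * dw 0 ^ 2 / 8)); [lra | |].
- intros s _.
  apply @is_derive_plus; [now apply is_derive_energy |].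
  auto_derive; [easy | field].
- intros s Hs. specialize (Hdw s ltac:(lra)).
  assert (Hlow : Rabs (dw 0) / 2 <= Rabs (dw s)).
  { pose proof (Rabs_triang_inv (dw 0) (dw s)) as H.
    rewrite Rabs_minus_sym in H. nra. }
  assert (dw 0 ^ 2 / 4 <= dw s ^ 2).
  { rewrite <- (pow2_abs (dw 0)), <- (pow2_abs (dw s)). nra. }
  nra.
Qed.

(** * Polynomial decay of the energy *)

(* Since [(w w' + t w^2 / 4)' = w'^2 - w f(w) + w^2 / 4], the correction trades the
   damping of the kinetic energy for decay of the potential energy. *)
Definition lyapunov (p a m : R) (w dw : R -> R) (t : R) : R :=
  Rpower t a * (V p (w t) (dw t) + m * (w t * dw t / t + w t ^ 2 / 4)).

(** The term [- w w' / 2] that the damping produces in [(w w' / t)'] cancels against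
    [(w^2 / 4)']. *)
Lemma is_derive_lyapunov (p a m : R) (w dw : R -> R) (t : R) :
  0 < p < 1 -> profile p w dw -> 0 < t ->
  is_derive (lyapunov p a m w dw) t
    (Rpower t a / t *
     (a * V p (w t) (dw t) - 1 / 2 * t ^ 2 * dw t ^ 2
      + m * ((a - 1) * (w t * dw t / t) + a * w t ^ 2 / 4 + dw t ^ 2
             - w t * force p (w t)))).
Proof.
intros Hp Hw Ht. destruct (Hw t) as [H1 H2].
pose proof (is_derive_energy p w dw t Hp Hw) as H3.
set (e := fun s => V p (w s) (dw s)).
change (is_derive e t (- (1 / 2) * t * dw t ^ 2)) in H3.
change (V p (w t) (dw t)) with (e t).
apply (is_derive_ext
  (fun s => exp (a * ln s) * (e s + m * (w s * dw s / s + w s ^ 2 / 4))));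
  [reflexivity |].
clearbody e. auto_derive; [repeat split; try lra; eexists; eassumption |].
replace (Derive (fun t : R => e t) t) with (- (1 / 2) * t * dw t ^ 2)
  by (symmetry; exact (is_derive_unique _ _ _ H3)).
replace (Derive (fun t : R => dw t) t) with (- (1 / 2 * t * dw t + force p (w t)))
  by (symmetry; exact (is_derive_unique _ _ _ H2)).
replace (Derive (fun t : R => w t) t) with (dw t)
  by (symmetry; exact (is_derive_unique _ _ _ H1)).
unfold Rpower. field. lra.
Qed.

(** For large times the damping, of size [t^2 w'^2], absorbs all kinetic terms in the derivative of
    [lyapunov]; the assumed inequality handles the remaining terms in [w], with [k w^2] set aside
    for the cross term. Up to time [M] the uniform bound on the energy suffices. [C] depends only on
    [a], [m], [k] and [t0]. *)
Lemma energy_decay (p a m k t0 : R) :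
  0 < p < 1 -> 0 < a -> 0 < m -> 0 < k ->
  exists C, 0 < C /\ forall w dw, profile p w dw ->
    admissible p (w 0) (dw 0) ->
    (forall t, t0 <= t ->
       a * pot p (w t) + (m * a / 4 + k) * w t ^ 2 <= m * (w t * force p (w t))) ->
    forall t, 0 <= t -> V p (w t) (dw t) * Rpower (1 + t) a <= C.
Proof.
intros Hp Ha Hm Hk.
(* The coefficient of [z^2] when [m (a - 1) x z] is split against [k x^2]. *)
set (c := m ^ 2 * (a - 1) ^ 2 / (4 * k)).
assert (Hc : 0 <= c).
{ apply Rdiv_le_0_compat; [| lra]. apply Rmult_le_pos; apply pow2_ge_0. }
(* Beyond [M] the inequality in [w] is available, and [s^2 >= s] exceeds both [a + 2 m + 2 c], which
   makes the damping dominate, and [4 m], which makes [lyapunov] control the energy. *)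
set (M := Rabs t0 + 1 + a + 4 * m + 2 * c).
assert (HM : t0 <= M /\ 1 + a + 4 * m + 2 * c <= M).
{ unfold M. pose proof (Rle_abs t0). pose proof (Rabs_pos t0). lra. }
clearbody M.
set (L := Rpower M a * (1 / 2 + 2 * m)).
pose proof (exp_pos (a * ln M)) as HMa. fold (Rpower M a) in HMa.
pose proof (exp_pos (a * ln 2)) as H2a. fold (Rpower 2 a) in H2a.
pose proof (exp_pos (a * ln (1 + M))) as HM1. fold (Rpower (1 + M) a) in HM1.
assert (HL : 0 < L) by (apply Rmult_lt_0_compat; lra).
(* The first summand serves [t <= M]. The second serves [t > M], where [1 + t <= 2 t] and
   [t^a V / 2 <= L]. *)
exists (Rpower (1 + M) a + Rpower 2 a * (2 * L)). split; [nra |].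
intros w dw Hw Hadm Hineq t Ht.
pose proof (profile_bounds p w dw Hp Hw Hadm) as HB.
destruct (Rle_or_lt t M) as [HtM | HMt].
{ destruct (HB t Ht) as (_ & _ & HV & Hpot & HV2 & _).
  assert (Rpower (1 + t) a <= Rpower (1 + M) a) by (apply Rle_Rpower_l; lra).
  pose proof (exp_pos (a * ln (1 + t))) as Hta. fold (Rpower (1 + t) a) in Hta.
  assert (0 < Rpower 2 a * (2 * L)) by nra.
  pose proof (pow2_ge_0 (dw t)). nra. }
assert (Hdecr : lyapunov p a m w dw t <= lyapunov p a m w dw M).
{ eapply is_derive_nonpos_decr; [lra | |].
  - intros s Hs. apply is_derive_lyapunov; try easy; lra.
  - intros s Hs. cbv beta.
    specialize (Hineq s ltac:(lra)). rewrite V_pot.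
    set (x := w s) in *. set (y := dw s) in *.
    enough (H : a * (1 / 2 * y ^ 2 + pot p x) - 1 / 2 * s ^ 2 * y ^ 2 +
      m * ((a - 1) * (x * y / s) + a * x ^ 2 / 4 + y ^ 2 - x * force p x) <= 0).
    { assert (0 < Rpower s a / s) by (apply Rdiv_lt_0_compat; [apply exp_pos | lra]).
      nra. }
    (* Young's inequality absorbs the cross term into [k x^2] and the damping. *)
    assert (Hyoung : m * ((a - 1) * (x * y / s)) <= k * x ^ 2 + c * y ^ 2).
    { set (z := y / s). replace (x * y / s) with (x * z) by (unfold z; field; lra).
      assert (Hz : z ^ 2 <= y ^ 2).
      { replace (y ^ 2) with (z ^ 2 * s ^ 2) by (unfold z; field; lra).
        rewrite <- (Rmult_1_r (z ^ 2)) at 1.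
        apply Rmult_le_compat_l; [apply pow2_ge_0 | apply pow_R1_Rle; lra]. }
      apply Rle_trans with (k * x ^ 2 + c * z ^ 2); [| nra].
      replace (k * x ^ 2 + c * z ^ 2)
        with (m * ((a - 1) * (x * z)) + k * (x - m * (a - 1) * z / (2 * k)) ^ 2)
        by (unfold c; field; lra).
      pose proof (pow2_ge_0 (x - m * (a - 1) * z / (2 * k))). nra. }
    assert (Hdamp : (a + 2 * m + 2 * c) * y ^ 2 <= s ^ 2 * y ^ 2).
    { apply Rmult_le_compat_r; [apply pow2_ge_0 |].
      assert (s <= s ^ 2) by (clear - Hs HM Ha Hm Hc; nra). lra. }
    lra. }
assert (HLM : lyapunov p a m w dw M <= L).
{ unfold lyapunov, L. apply Rmult_le_compat_l; [lra |].
  destruct (HB M ltac:(lra)) as (_ & Hx & HV & _ & _ & Hy).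
  assert (w M * dw M / M <= 1).
  { apply Rle_div_l; [lra |]. apply Rabs_le_between in Hx, Hy. nra. }
  assert (w M ^ 2 <= 1) by (apply Rabs_le_between in Hx; nra).
  nra. }
(* Completing the square as [m (x/2 + z)^2], the correction is at least [- m z^2 >= - y^2 / 4],
   hence at least [- V / 2]. *)
assert (Hlow : Rpower t a * (V p (w t) (dw t) / 2) <= lyapunov p a m w dw t).
{ apply Rmult_le_compat_l; [left; apply exp_pos |].
  destruct (HB t Ht) as (_ & _ & _ & _ & HV & _).
  set (x := w t) in *. set (y := dw t) in *.
  set (z := y / t). replace (x * y / t) with (x * z) by (unfold z; field; lra).
  assert (m * z ^ 2 <= 1 / 4 * y ^ 2).
  { replace (y ^ 2) with (t ^ 2 * z ^ 2) by (unfold z; field; lra).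
    rewrite <- Rmult_assoc. apply Rmult_le_compat_r; [apply pow2_ge_0 |].
    assert (t <= t ^ 2) by (clear - HMt HM Ha Hm Hc; nra). lra. }
  pose proof (Rmult_le_pos m _ (Rlt_le _ _ Hm) (pow2_ge_0 (x / 2 + z))). lra. }
destruct (HB t Ht) as (_ & _ & _ & _ & HV & _).
assert (H1 : Rpower (1 + t) a <= Rpower 2 a * Rpower t a).
{ rewrite Rpower_mult_distr by lra. apply Rle_Rpower_l; lra. }
pose proof (pow2_ge_0 (dw t)).
apply Rle_trans with (V p (w t) (dw t) * (Rpower 2 a * Rpower t a)); [nra |].
assert (Rpower t a * V p (w t) (dw t) <= 2 * L) by lra. nra.
Qed.

(** * From a slow rate to every rate *)

(** The energy gap at time 1 yields a coercivity constant [k], hence decay at the possibly very slow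
    rate [k], which already forces [w] to 0. The time [t0] depends on the initial data and not on
    the solution. *)
Lemma profile_small (p x0 y0 s : R) : 0 < p < 1 -> admissible p x0 y0 -> 0 < s ->
  exists t0, forall w dw, profile p w dw -> w 0 = x0 -> dw 0 = y0 ->
    forall t, t0 <= t -> Rabs (w t) <= s.
Proof.
intros Hp Hadm Hs.
destruct (energy_gap p x0 y0 Hp Hadm) as [d [Hd Hgap]].
destruct (pot_gap p d Hp Hd) as [k [Hk Hpot]].
(* With [a = k] and [m = 4], the left side of the required inequality is at most [3 k |w|^(1+p)] and
   the right side at least [4 k |w|^(1+p)]. *)
destruct (energy_decay p k 4 k 1 Hp) as [C [HC Hdec]]; try lra.
(* [|w| > s] costs energy at least [q], while from the chosen time on [(1 + t)^k >= 2 C / q]; the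
   product would exceed [C]. *)
set (q := (1 - p) / (2 * (1 + p)) * abspow s (1 + p)).
assert (Hq : 0 < q).
{ apply Rmult_lt_0_compat; [apply Rdiv_lt_0_compat | apply abspow_pos]; lra. }
exists (Rmax 0 (Rpower (2 * C / q) (/ k))). intros w dw Hw Hw0 Hdw0 t Ht.
subst x0 y0.
assert (Ht0 : 0 <= t) by (eapply Rle_trans; [apply Rmax_l | exact Ht]).
assert (Ht1 : Rpower (2 * C / q) (/ k) <= t)
  by (eapply Rle_trans; [apply Rmax_r | exact Ht]).
pose proof (profile_bounds p w dw Hp Hw Hadm) as HB.
destruct (Rle_or_lt (Rabs (w t)) s) as [| Hlt]; [easy | exfalso].
assert (HE : V p (w t) (dw t) * Rpower (1 + t) k <= C).
{ apply Hdec; try easy. intros r Hr.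
  destruct (HB r ltac:(lra)) as (Hx & Hx1 & _).
  assert (Hpr : pot p (w r) <= cstar p - d).
  { specialize (Hgap w dw Hw eq_refl eq_refl r Hr). rewrite V_pot in Hgap.
    pose proof (pow2_ge_0 (dw r)). lra. }
  specialize (Hpot (w r) Hx Hpr).
  set (Q := abspow (w r) (1 + p)) in *.
  assert (HQ : 0 <= Q) by apply abspow_ge0.
  assert (Hup : k * pot p (w r) <= k * Q)
    by (apply Rmult_le_compat_l; [lra | now apply pot_upper]).
  assert (Hsq : w r ^ 2 <= (1 - p) * Q) by (apply sqr_le_xstar; [easy | lra]).
  assert (Hk2 : k * w r ^ 2 <= k * Q) by (apply Rmult_le_compat_l; [lra | nra]).
  assert (0 <= k * Q) by (apply Rmult_le_pos; lra). lra. }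
assert (Hqw : q <= V p (w t) (dw t)).
{ destruct (HB t Ht0) as (Hx & _). rewrite V_pot.
  pose proof (pot_lower p (w t) Hp ltac:(lra)).
  assert (q <= (1 - p) / (2 * (1 + p)) * abspow (w t) (1 + p)).
  { apply Rmult_le_compat_l; [left; apply Rdiv_lt_0_compat; lra |].
    apply abspow_le; [lra |]. rewrite (Rabs_pos_eq s); lra. }
  pose proof (pow2_ge_0 (dw t)). lra. }
assert (HT : 2 * C / q <= Rpower (1 + t) k).
{ assert (H0 : 0 < 2 * C / q) by (apply Rdiv_lt_0_compat; lra).
  rewrite <- (Rpower_1 (2 * C / q)) by easy.
  replace 1 with (/ k * k) at 1 by (field; lra). rewrite <- Rpower_mult.
  apply Rle_Rpower_l; [lra |]. split; [apply exp_pos | lra]. }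
assert (Hqc : q * (2 * C / q) = 2 * C) by (field; lra).
assert (q * (2 * C / q) <= V p (w t) (dw t) * Rpower (1 + t) k).
{ apply Rmult_le_compat; try lra. left; apply Rdiv_lt_0_compat; lra. }
lra.
Qed.

Lemma energy_decay_any (p a x0 y0 : R) : 0 < p < 1 -> 0 < a -> admissible p x0 y0 ->
  exists C, 0 < C /\ forall w dw, profile p w dw -> w 0 = x0 -> dw 0 = y0 ->
    forall t, 0 <= t -> V p (w t) (dw t) * Rpower (1 + t) a <= C.
Proof.
intros Hp Ha Hadm.
(* With [m = 2 a] and [k = 1], using [pot <= |w|^(1+p)], the required inequality reduces to
   [b w^2 <= a |w|^(1+p)]. The threshold [s] solves [b s^(1-p) = a]. *)
set (b := a ^ 2 / 2 + 1 + 2 * a / (1 - p)).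
assert (Hb : 0 < b).
{ unfold b. assert (0 < 2 * a / (1 - p)) by (apply Rdiv_lt_0_compat; lra). nra. }
set (s := Rpower (a / b) (/ (1 - p))).
assert (Hs : 0 < s) by apply exp_pos.
assert (Hsb : b * abspow s (1 - p) = a).
{ rewrite abspow_neq0, Rabs_pos_eq by lra. unfold s. rewrite Rpower_mult.
  replace (/ (1 - p) * (1 - p)) with 1 by (field; lra).
  rewrite Rpower_1 by (apply Rdiv_lt_0_compat; lra). field. lra. }
destruct (profile_small p x0 y0 s Hp Hadm Hs) as [t0 Hsmall].
destruct (energy_decay p a (2 * a) 1 t0 Hp) as [C [HC Hdec]]; try lra.
exists C. split; [easy |]. intros w dw Hw Hw0 Hdw0.
apply Hdec; [easy | now rewrite Hw0, Hdw0 |].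
intros t Ht. specialize (Hsmall w dw Hw Hw0 Hdw0 t Ht).
assert (Hsq : w t ^ 2 <= abspow s (1 - p) * abspow (w t) (1 + p)).
{ apply sqr_le_abspow; [easy |]. now rewrite (Rabs_pos_eq s) by lra. }
apply Rmult_le_compat_l with (r := b) in Hsq; [| lra].
rewrite <- Rmult_assoc, Hsb in Hsq. unfold b in Hsq.
rewrite force_mul. pose proof (pot_upper p (w t) Hp).
replace (2 * a / (1 - p)) with (2 * a * (1 / (1 - p))) in Hsq by (field; lra).
nra.
Qed.

(** For [|z| > 1] one has [|z| <= |z|^a]; this replaces the extraction of a root when only some
    constant is wanted. *)
Lemma Rle_of_abspow_le (z a C : R) : 1 <= a -> abspow z a <= C -> Rabs z <= 1 + C.
Proof.
intros Ha Hz. pose proof (abspow_ge0 z a).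
destruct (Rle_or_lt (Rabs z) 1) as [| H1]; [lra |].
enough (Rabs z <= abspow z a) by lra.
assert (z <> 0) by (intros ->; rewrite Rabs_R0 in H1; lra).
rewrite abspow_neq0 by easy. rewrite <- (Rpower_1 (Rabs z)) at 1 by lra.
apply Rle_Rpower; lra.
Qed.

(** Energy decay with exponent [2 (1+p) / (1-p)] gives both rates: the energy controls [|w|^(1+p)]
    through [pot_lower], and [w'^2 <= 2 V] halves the exponent. *)
Lemma profile_decay (p x0 y0 : R) : 0 < p < 1 -> admissible p x0 y0 ->
  exists C, 0 < C /\ forall w dw, profile p w dw -> w 0 = x0 -> dw 0 = y0 ->
    forall t, 0 <= t ->
      Rabs (w t) * Rpower (1 + t) (2 / (1 - p)) < C /\
      Rabs (dw t) * Rpower (1 + t) ((1 + p) / (1 - p)) < C.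
Proof.
intros Hp Hadm.
set (r := 2 / (1 - p)).
assert (Hr : 0 < r) by (apply Rdiv_lt_0_compat; lra).
destruct (energy_decay_any p (r * (1 + p)) x0 y0 Hp) as [C [HC Hdec]]; [nra | easy |].
set (h := (1 - p) / (2 * (1 + p))).
assert (Hh : 0 < h) by (apply Rdiv_lt_0_compat; lra).
assert (HCh : 0 < C / h) by (apply Rdiv_lt_0_compat; lra).
exists (2 + C / h + 2 * C). split; [lra |].
intros w dw Hw Hw0 Hdw0 t Ht. specialize (Hdec w dw Hw Hw0 Hdw0 t Ht).
subst x0 y0.
destruct (profile_bounds p w dw Hp Hw Hadm t Ht) as (Hx & _ & _ & _ & HV & _).
assert (Hpos : forall b, 0 < Rpower (1 + t) b) by (intros b; apply exp_pos).
split.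
- rewrite <- (Rabs_pos_eq (Rpower (1 + t) r)), <- Rabs_mult by (left; apply Hpos).
  apply Rle_lt_trans with (1 + C / h); [| lra].
  apply Rle_of_abspow_le with (1 + p); [lra |].
  rewrite abspow_mult_distr, (abspow_neq0 (Rpower _ _)) by (apply Rgt_not_eq, Hpos).
  rewrite (Rabs_pos_eq (Rpower _ _)), Rpower_mult by (left; apply Hpos).
  apply (proj1 (Rle_div_r _ C h Hh)).
  pose proof (pot_lower p (w t) Hp ltac:(lra)) as Hlow. fold h in Hlow.
  rewrite V_pot in Hdec. pose proof (pow2_ge_0 (dw t)).
  specialize (Hpos (r * (1 + p))). nra.
- set (g := (1 + p) / (1 - p)).
  rewrite <- (Rabs_pos_eq (Rpower (1 + t) g)), <- Rabs_mult by (left; apply Hpos).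
  apply Rle_lt_trans with (1 + 2 * C); [| lra].
  apply Rle_of_abspow_le with 2; [lra |].
  rewrite abspow_mult_distr, abspow_2, (abspow_neq0 (Rpower _ _)) by (apply Rgt_not_eq, Hpos).
  rewrite (Rabs_pos_eq (Rpower _ _)), Rpower_mult by (left; apply Hpos).
  replace (g * 2) with (r * (1 + p)) by (unfold g, r; field; lra).
  specialize (Hpos (r * (1 + p))). nra.
Qed.

(** * Reflection in time, the closed well, and the conclusion *)

Lemma profile_reflect (p : R) (w dw : R -> R) :
  profile p w dw -> profile p (fun t => w (- t)) (fun t => - dw (- t)).
Proof.
intros Hw t. destruct (Hw (- t)) as [H1 H2].
assert (Hopp : is_derive (fun s : R => - s) t (- 1)) by (auto_derive; [exact I | ring]).
split.
- replace (- dw (- t)) with (dw (- t) * - 1) by ring.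
  now apply is_derive_comp_R.
- replace (- (1 / 2 * t * - dw (- t) + force p (w (- t))))
    with (- (- (1 / 2 * (- t) * dw (- t) + force p (w (- t))) * - 1)) by field.
  apply @is_derive_opp. now apply is_derive_comp_R.
Qed.

Lemma admissible_opp (p a b : R) : admissible p a b -> admissible p a (- b).
Proof.
intros [H1 H2]. split; [easy |]. rewrite V_pot in *.
replace ((- b) ^ 2) with (b ^ 2) by ring. easy.
Qed.

Lemma closure_le {T : UniformSpace} (A : T -> Prop) (f : T -> R) (c : R) (z : T) :
  continuous f z -> (forall u, A u -> f u <= c) -> closure A z -> f z <= c.
Proof.
intros Hf HA Hz. destruct (Rle_or_lt (f z) c) as [| Hlt]; [easy | exfalso].
destruct (Hf (fun y => c < y) (open_gt c (f z) Hlt)) as [e He].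
destruct (Hz e) as [u [Hu HAu]]. specialize (He u Hu). specialize (HA u HAu). simpl in He.
lra.
Qed.

Lemma continuous_V (p : R) (z : R * R) : 0 < p < 1 ->
  continuous (fun u => V p (fst u) (snd u)) z.
Proof.
intros Hp.
apply (continuous_ext (fun u : R * R => plus (1 / 2 * snd u ^ 2) (pot p (fst u)))).
{ intros u. now rewrite V_pot. }
apply @continuous_plus.
- apply (continuous_comp snd (fun y : R => 1 / 2 * y ^ 2)); [apply continuous_snd |].
  apply @ex_derive_continuous. auto_derive. exact I.
- apply (continuous_comp fst (pot p)); [apply continuous_fst |].
  apply @ex_derive_continuous. eexists. now apply is_derive_pot.
Qed.

(** Both weak inequalities pass to the closure. If [|a| = xstar], the potential alone uses up
    [cstar], so [b = 0] and the point is an excluded corner. *)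
Lemma Dbar'_admissible (p a b : R) : 0 < p < 1 -> Dbar' p (a, b) -> admissible p a b.
Proof.
intros Hp (Hcl & Hr & Hl & _).
assert (Ha : Rabs a <= xstar p).
{ apply (closure_le (Defs.D p (cstar p)) (fun u => Rabs (fst u)) (xstar p) (a, b)); [| | easy].
  - apply (continuous_comp fst Rabs); [apply continuous_fst | apply continuous_Rabs].
  - intros u [H _]. now left. }
assert (HV : V p a b <= cstar p).
{ apply (closure_le (Defs.D p (cstar p)) (fun u => V p (fst u) (snd u)) (cstar p) (a, b)); [| | easy].
  - now apply continuous_V.
  - intros u [_ H]. now left. }
split; [| easy].
destruct Ha as [| Heq]; [easy | exfalso].
rewrite V_pot, (pot_xstar p a Hp Heq) in HV.
assert (b = 0) by nra. subst b.
destruct (Rcase_abs a) as [Hneg | Hpos].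
- rewrite Rabs_left in Heq by easy. apply Hl. f_equal. lra.
- rewrite Rabs_right in Heq by easy. apply Hr. now f_equal.
Qed.

Lemma is_solution_profile (p : R) (ab : R * R) (w : R -> R) :
  is_solution p ab w -> profile p w (Derive w).
Proof.
intros ((H1 & H2 & _) & _ & Heq & _) t. split; [now apply Derive_correct |].
specialize (Heq t). change (Derive_n w 2 t) with (Derive (Derive w) t) in Heq.
replace (- (1 / 2 * t * Derive w t + force p (w t))) with (Derive (Derive w) t).
- now apply Derive_correct.
- unfold force. lra.
Qed.

Theorem theorem10 (p alpha beta : R) :
  0 < p < 1 ->
  Dbar' p (alpha, beta) ->
  forall eps : R, 0 < eps ->
  exists c1 c2 : R, 0 < c1 /\ 0 < c2 /\
    forall w : R -> R, is_solution p (alpha, beta) w ->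
    forall eta : R,
      Rabs (w eta) < c1 / Rpower (1 + Rabs eta) (2 / (1 - p) - eps) /\
      Rabs (Derive w eta)
        < c2 / Rpower (1 + Rabs eta) ((1 + p) / (1 - p) - eps).
Proof.
intros Hp HD eps Heps.
pose proof (Dbar'_admissible p alpha beta Hp HD) as Hadm.
destruct (profile_decay p alpha beta Hp Hadm) as [C1 [HC1 H1]].
(* Negative times are nonnegative times of the reflected solution, whose initial slope is
   [- beta]. *)
destruct (profile_decay p alpha (- beta) Hp (admissible_opp _ _ _ Hadm)) as [C2 [HC2 H2]].
exists (C1 + C2), (C1 + C2). split; [lra | split; [lra |]].
intros w Hw eta.
pose proof (is_solution_profile p _ w Hw) as Hprof.
destruct Hw as (_ & _ & _ & Hw0 & Hdw0). simpl in Hw0, Hdw0.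
(* Passing to the exponent [r - eps] only decreases the power, because its base is at least 1. *)
assert (Hdrop : forall u r, 0 <= u -> u * Rpower (1 + Rabs eta) r < C1 + C2 ->
  u < (C1 + C2) / Rpower (1 + Rabs eta) (r - eps)).
{ intros u r Hu Hlt. apply Rlt_div_r; [apply exp_pos |].
  eapply Rle_lt_trans; [| exact Hlt]. apply Rmult_le_compat_l; [easy |].
  apply Rle_Rpower; [| lra]. pose proof (Rabs_pos eta). lra. }
enough (Rabs (w eta) * Rpower (1 + Rabs eta) (2 / (1 - p)) < C1 + C2 /\
        Rabs (Derive w eta) * Rpower (1 + Rabs eta) ((1 + p) / (1 - p)) < C1 + C2)
  by (split; apply Hdrop; try apply Rabs_pos; easy).
destruct (Rle_or_lt 0 eta) as [Heta | Heta].
- rewrite (Rabs_pos_eq eta) by easy.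
  destruct (H1 w (Derive w) Hprof Hw0 Hdw0 eta Heta). lra.
- rewrite (Rabs_left eta) by easy.
  destruct (H2 _ _ (profile_reflect p w _ Hprof)) with (t := - eta) as [Ha Hb].
  + now rewrite Ropp_0.
  + now rewrite Ropp_0, Hdw0.
  + lra.
  + rewrite Ropp_involutive in Ha, Hb. rewrite Rabs_Ropp in Hb. lra.
Qed.
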